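(* Let $\omega=\{\gamma_{ij}\}_{0\le i+j\le 6}$ be complex numbers with $\overline{\gamma_{ij}}=\gamma_{ji}$ and $\gamma_{00}>0$, and let $M(\omega)(3)$ be the associated moment matrix. Assume that $M(\omega)(3)\ge0$ and that its columns satisfy $Z^3=itZ+u\bar Z$, where $t,u\in\mathbb{R}$ and $u<t<2u$. Let $h(z,\bar z)=i(z-i\bar z)(z\bar z-u)$, and let $\gamma=\{\gamma_{ij}\}_{i,j\ge0}$ be the recursive doubly indexed sequence (RDIS) with initial conditions $\{\gamma_{ij}\}_{0\le i\le j\le2}$ (taken from $\omega$) and characteristic polynomial $P(z,\bar z)=z^3-itz-u\bar z$. Then the following are equivalent: (i) there exists a representing measure for $\omega$; (ii) there exists a representing measure for $\gamma$; (iii) $\Lambda_\omega(h)=0$ and $\Lambda_\omega(zh)=0$; (iv) $\operatorname{Re}\gamma_{12}-\operatorname{Im}\gamma_{12}=u(\operatorname{Re}\gamma_{01}-\operatorname{Im}\gamma_{01})$ and $\gamma_{22}=(t+u)\gamma_{11}-2u\operatorname{Im}\gamma_{02}$; (v) $h\in\mathcal{P}_\gamma$; (vi) the columns of $M(\omega)(3)$ satisfy $Z^2\bar Z-iZ\bar Z^2-uZ+iu\bar Z=0$.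
   Context: $i$ in coefficients is the imaginary unit. $M(\omega)(3)$ is the matrix with rows and columns indexed by the monomials $\bar z^pz^q$, $p+q\le3$, whose entry in row $\bar z^kz^l$, column $\bar z^pz^q$ is $\gamma_{p+l,q+k}$; its column indexed by $\bar z^pz^q$ is denoted $\bar Z^pZ^q$. $\ge0$ means positive semidefinite. $\Lambda_\omega$ is the linear functional on polynomials in $z,\bar z$ of total degree $\le6$ with $\Lambda_\omega(\bar z^pz^q)=\gamma_{pq}$. A representing measure for a (finite or infinite) family $\{\gamma_{pq}\}$ is a positive Borel measure $\mu$ on $\mathbb{C}$ with $\gamma_{pq}=\int\bar z^pz^q\,d\mu$ for all indices $(p,q)$ of the family. The RDIS with initial conditions $\{\gamma_{pq}\}_{0\le p\le q\le s-1}$ and characteristic polynomial $z^s-\sum_{0\le l+k\le s-1}a_{lk}\bar z^lz^k$ is the (unique) sequence $\{\gamma_{pq}\}_{p,q\ge0}$ having these initial values and satisfying $\gamma_{qp}=\overline{\gamma_{pq}}$ and $\gamma_{p,q+s}=\sum_{0\le l+k\le s-1}a_{lk}\gamma_{p+l,q+k}$ for all $p,q\ge0$. $\mathcal{P}_\gamma$ is the set of characteristic polynomials of $\gamma$: all $g=\sum g_{lk}\bar z^lz^k$ ($z,\bar z$ commuting indeterminates) with $\sum g_{lk}\gamma_{p+l,q+k}=0$ for all $p,q\ge0$. *)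

(* Defs.v *)
From mathcomp Require Import all_boot all_order all_algebra.
From mathcomp Require Import complex.
From mathcomp Require Import all_classical all_reals all_analysis.

Set Implicit Arguments.
Unset Strict Implicit.
Unset Printing Implicit Defensive.

Import Order.TTheory GRing.Theory Num.Theory.
Import numFieldNormedType.Exports.

(* ring_scope is opened last, so that [^*] is [Num.conj]; the imaginary unit is
   always written ['i%C], i.e. [Complex 0 1]. *)
Local Open Scope complex_scope.
Local Open Scope ring_scope.

(* C with the sigma-algebra generated by its open sets. *)
Notation borelC R := (g_sigma_algebraType (@open (R[i])^o)).

(* [I] is the index set of the family; values of [gamma] off [I] are irrelevant.
   Integrability makes the integral of the complex monomial meaningful: the
   library's [Rintegral] is total. *)
Definition represents (R : realType) (I : nat -> nat -> bool)
    (gamma : nat -> nat -> R[i]) (mu : {measure set (borelC R) -> \bar R}) :=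
  forall p q : nat, I p q ->
    let f := fun z : R[i] => z^* ^+ p * z ^+ q in
    [/\ mu.-integrable setT (fun z : borelC R => (complex.Re (f z))%:E),
        mu.-integrable setT (fun z : borelC R => (complex.Im (f z))%:E) &
        gamma p q =
          Complex (\int[mu]_(z in [set: borelC R]) complex.Re (f z))
                  (\int[mu]_(z in [set: borelC R]) complex.Im (f z))].

Definition has_representing_measure (R : realType) (I : nat -> nat -> bool)
    (gamma : nat -> nat -> R[i]) :=
  exists mu : {measure set (borelC R) -> \bar R}, represents I gamma mu.

(* The pair (p, q) stands for the monomial zbar^p z^q. *)
Definition monom (n : nat) : predArgType :=
  {m : 'I_n.+1 * 'I_n.+1 | (m.1 + m.2 <= n)%N}.

Definition deg_zb n (m : monom n) : nat := (val m).1.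
Definition deg_z n (m : monom n) : nat := (val m).2.

(* Row zbar^k z^l, column zbar^p z^q has entry gamma_(p+l, q+k). *)
Definition moment_mx (R : realType) (n : nat) (gamma : nat -> nat -> R[i]) :
    'M[R[i]]_#|monom n| :=
  \matrix_(i, j)
    let r : monom n := enum_val i in
    let c : monom n := enum_val j in
    gamma (deg_zb c + deg_z r)%N (deg_z c + deg_zb r)%N.

Definition monom1 n : monom n := exist _ (ord0, ord0) (leq0n n).

Definition monom_of n (p q : nat) : monom n :=
  insubd (monom1 n) (inord p, inord q).

(* The column indexed by zbar^p z^q; only meaningful for p + q <= n. *)
Definition moment_col (R : realType) (n : nat) (gamma : nat -> nat -> R[i])
    (p q : nat) : 'cV[R[i]]_#|monom n| :=
  col (enum_rank (monom_of n p q)) (moment_mx n gamma).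

Lemma moment_colE (R : realType) n (gamma : nat -> nat -> R[i]) p q i :
  (p + q <= n)%N ->
  moment_col n gamma p q i 0 =
    gamma (p + deg_z (enum_val i))%N (q + deg_zb (enum_val i))%N.
Proof.
move=> pqn; rewrite !mxE enum_rankK /deg_zb /deg_z /monom_of.
have pn : (p < n.+1)%N by rewrite ltnS (leq_trans (leq_addr q p)).
have qn : (q < n.+1)%N by rewrite ltnS (leq_trans (leq_addl p q)).
by rewrite val_insubd /= !inordK // pqn /= !inordK.
Qed.

(* [0 <= x] in R[i] means that x is real and nonnegative. *)
Definition psdmx (R : realType) (n : nat) (M : 'M[R[i]]_n) :=
  forall v : 'cV[R[i]]_n, 0 <= ((map_mx Num.conj v)^T *m M *m v) 0 0.

(* Polynomials in the commuting indeterminates z (inner variable) and zbar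
   (outer variable): the coefficient of zbar^l z^k in g is [g`_l`_k]. *)
Notation zpoly R := {poly {poly R[i]}}.

Definition Zbar {R : realType} : zpoly R := 'X.
Definition Z {R : realType} : zpoly R := 'X%:P.
Definition cpoly {R : realType} (c : R[i]) : zpoly R := c%:P%:P.

(* The functional zbar^p z^q |-> gamma_pq on polynomials of total degree <= d;
   terms of higher degree are ignored. *)
Definition Lambda (R : realType) (d : nat) (gamma : nat -> nat -> R[i])
    (g : zpoly R) : R[i] :=
  \sum_(l < d.+1) \sum_(k < d.+1 | (l + k <= d)%N) g`_l`_k * gamma l k.

Definition rdis_poly (R : realType) (s : nat) (a : nat -> nat -> R[i]) :
    zpoly R :=
  Z ^+ s - \sum_(l < s) \sum_(k < s | (l + k < s)%N)
             cpoly (a l k) * Zbar ^+ l * Z ^+ k.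

(* [gamma] is the RDIS of order [s] with initial conditions [init p q],
   0 <= p <= q <= s-1, and characteristic polynomial [P]. *)
Definition is_RDIS (R : realType) (s : nat) (init : nat -> nat -> R[i])
    (P : zpoly R) (gamma : nat -> nat -> R[i]) :=
  exists2 a : nat -> nat -> R[i], P = rdis_poly s a &
    [/\ forall p q, (p <= q < s)%N -> gamma p q = init p q,
        forall p q, gamma q p = (gamma p q)^* &
        forall p q, gamma p (q + s)%N =
          \sum_(l < s) \sum_(k < s | (l + k < s)%N)
             a l k * gamma (p + l)%N (q + k)%N].

Definition charpolys (R : realType) (gamma : nat -> nat -> R[i]) :
    set (zpoly R) :=
  [set g : zpoly R | forall p q : nat,
     \sum_(l < size g) \sum_(k < size g`_l)
        g`_l`_k * gamma (p + l)%N (q + k)%N = 0].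

(* Main.v *)
(* Put w = zbar and H(p, q) = L(w^p z^q h), where L is the functional z^q w^p
   |-> gamma_pq, which kills the ideal I generated by P and its conjugate. Since
   (w - i z) h and (z^2 - i (t + u)) h lie in I, the two values H(0, 0) and
   H(0, 1) determine all of H; their vanishing is (iii), (iv), (v) and (vi).

   On the real zero set of P one has h = 0. A representing measure of omega gives
   |P|^2 integral 0, hence is carried by that set, hence H(0, 0) = H(0, 1) = 0.

   Conversely P has seven zeros, and modulo I + (h) every monomial reduces to
   seven of them, so if H = 0 then gamma is a combination of the evaluations at
   the zeros. For each zero some cubic vanishes at the other six but not there;
   positivity of M(omega)(3) on it makes the corresponding weight nonnegative. *)
Require Import Defs.
From mathcomp Require Import all_boot all_order all_algebra.
From mathcomp Require Import complex.
From mathcomp Require Import all_classical all_reals all_analysis.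
From mathcomp Require Import measurable_realfun.
From mathcomp Require Import zify ring lra.
Import Order.TTheory GRing.Theory Num.Theory.
Import numFieldNormedType.Exports.
Local Open Scope complex_scope.
Local Open Scope ring_scope.

Set Implicit Arguments.
Unset Strict Implicit.

(** * Borel measurability and integration of complex functions *)

Lemma normc_ge_Im (R : rcfType) (x : R[i]) : `|complex.Im x|%:C <= `|x|.
Proof.
have := normc_ge_Re ('i%C * x); rewrite mulrC ReiNIm normrN normrM.
by rewrite (_ : `|'i%C| = 1) ?mulr1 // normc_def /= expr0n expr1n add0r sqrtr1.
Qed.

(** Continuity makes preimages of open intervals open, and open intervals generate the Borel sets of
    [R]. *)
Lemma measurable_borelC_lipschitz (R : realType) (f : R[i] -> R) :
  (forall x y : R[i], `|f x - f y|%:C <= `|x - y|) ->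
  measurable_fun setT (f : borelC R -> R).
Proof.
move=> f_lip; apply: (@measurability _ _ _ _ _ (f : borelC R -> R) _
  (RGenOpens.measurableE R)).
move=> _ [_ [a [b ->]] <-]; rewrite setTI; apply: sub_sigma_algebra.
have cf : continuous (f : (R[i])^o -> R).
  move=> x A /nbhs_ballP[e /= e0 eA]; apply/nbhs_ballP.
  (* Balls of [R[i]] have their radii in [R[i]], hence the cast of the real [e]. *)
  exists e%:C; first by rewrite /= ltcR.
  move=> y; rewrite /ball /= => xy; apply: eA.
  by rewrite /ball /= -ltcR; apply: le_lt_trans xy.
by apply: open_comp => // x _; exact: cf.
Qed.

Lemma measurable_borelC_Re (R : realType) :
  measurable_fun setT (@complex.Re R : borelC R -> R).
Proof.
apply: measurable_borelC_lipschitz => -[a b] [c d].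
exact: (normc_ge_Re (Complex (a - c) (b - d))).
Qed.

Lemma measurable_borelC_Im (R : realType) :
  measurable_fun setT (@complex.Im R : borelC R -> R).
Proof.
apply: measurable_borelC_lipschitz => -[a b] [c d].
exact: (normc_ge_Im (Complex (a - c) (b - d))).
Qed.

(** The condition in [represents], freed from monomials so that linearity of the integral can be
    used. *)
Definition has_cintegral (R : realType) (mu : {measure set (borelC R) -> \bar R})
    (f : R[i] -> R[i]) (v : R[i]) :=
  [/\ mu.-integrable setT (fun z : borelC R => (complex.Re (f z))%:E),
      mu.-integrable setT (fun z : borelC R => (complex.Im (f z))%:E) &
      v = Complex (\int[mu]_(z in [set: borelC R]) complex.Re (f z))
                  (\int[mu]_(z in [set: borelC R]) complex.Im (f z))].

Section ComplexIntegral.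
Variables (R : realType) (mu : {measure set (borelC R) -> \bar R}).
Implicit Types (f g : R[i] -> R[i]) (v w c : R[i]).

Lemma eq_has_cintegral f g v w :
  f =1 g -> v = w -> has_cintegral mu f v -> has_cintegral mu g w.
Proof. by move=> /funext -> ->. Qed.

Lemma has_cintegralD f g v w : has_cintegral mu f v -> has_cintegral mu g w ->
  has_cintegral mu (fun z => f z + g z) (v + w).
Proof.
move=> [fR fI ->] [gR gI ->].
have ReD z : complex.Re (f z + g z) = complex.Re (f z) + complex.Re (g z).
  by case: (f z) (g z) => [? ?] [? ?].
have ImD z : complex.Im (f z + g z) = complex.Im (f z) + complex.Im (g z).
  by case: (f z) (g z) => [? ?] [? ?].
split.
- under eq_fun do rewrite ReD EFinD; exact: integrableD.
- under eq_fun do rewrite ImD EFinD; exact: integrableD.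
- under [X in _ = Complex X _]eq_Rintegral do rewrite ReD.
  under [X in _ = Complex _ X]eq_Rintegral do rewrite ImD.
  by rewrite !RintegralD.
Qed.

Lemma has_cintegralZ c f v : has_cintegral mu f v ->
  has_cintegral mu (fun z => c * f z) (c * v).
Proof.
case: c => a b [fR fI ->].
have ReZ z : complex.Re (Complex a b * f z) =
    a * complex.Re (f z) + (- b) * complex.Im (f z).
  by case: (f z) => [? ?] /=; rewrite mulNr.
have ImZ z : complex.Im (Complex a b * f z) =
    a * complex.Im (f z) + b * complex.Re (f z).
  by case: (f z) => [? ?] /=.
have iZ (k : R) (g : R[i] -> R) :
    mu.-integrable setT (fun z : borelC R => (g z)%:E) ->
    mu.-integrable setT (fun z : borelC R => (k * g z)%:E).
  by move=> gi; under eq_fun do rewrite EFinM; exact: integrableZl.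
split.
- by under eq_fun do rewrite ReZ EFinD; apply: integrableD => //; exact: iZ.
- by under eq_fun do rewrite ImZ EFinD; apply: integrableD => //; exact: iZ.
- under [X in _ = Complex X _]eq_Rintegral do rewrite ReZ.
  under [X in _ = Complex _ X]eq_Rintegral do rewrite ImZ.
  rewrite !RintegralD; try by [|exact: iZ].
  by rewrite !RintegralZl// mulNr; simpc.
Qed.

(** As $|f|^2$ is nonnegative with integral zero, [f] vanishes almost everywhere, and so does
    [g]. *)
Lemma has_cintegral_ae0 f g w : has_cintegral mu (fun z => `|f z| ^+ 2) 0 ->
  (forall z, f z = 0 -> g z = 0) -> has_cintegral mu g w -> w = 0.
Proof.
move=> [fi _ /(congr1 (@complex.Re R)) f0] fg [gR gI ->].
have nf z : complex.Re (`|f z| ^+ 2) = complex.Re (f z) ^+ 2 + complex.Im (f z) ^+ 2.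
  by rewrite -add_Re2_Im2.
have f_ge0 z : 0 <= complex.Re (`|f z| ^+ 2).
  by rewrite nf addr_ge0 // sqr_ge0.
have fae : {ae mu, forall z : borelC R,
    setT z -> (complex.Re (`|f z| ^+ 2))%:E = 0%E}.
  apply/(ae_eq_integral_abs mu measurableT).
    by have /integrableP[] := fi.
  rewrite (eq_integral (fun z : borelC R => (complex.Re (`|f z| ^+ 2))%:E)); last first.
    by move=> z _; rewrite gee0_abs // lee_fin f_ge0.
  rewrite -[LHS]fineK; last exact: integrable_fin_num.
  by rewrite -[X in X%:E]f0.
have g0 (k : R[i] -> R) : mu.-integrable setT (fun z : borelC R => (k z)%:E) ->
    (forall z, g z = 0 -> k z = 0) -> \int[mu]_(z in [set: borelC R]) k z = 0.
  move=> ki kg; rewrite /Rintegral (ae_eq_integral (cst 0%E)) ?integral0 //.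
    by have /integrableP[] := ki.
  apply: filterS fae => z + zT => /(_ zT)/(congr1 (@fine R)) fz0.
  have /eqP := fz0 : complex.Re (`|f z| ^+ 2) = 0.
  rewrite nf paddr_eq0 ?sqr_ge0 // !sqrf_eq0 => /andP[/eqP f1 /eqP f2].
  congr (_%:E); apply/kg/fg.
  by move: f1 f2; case: (f z) => a b /= -> ->.
by rewrite !g0 // => z ->.
Qed.

End ComplexIntegral.

(** * Finitely atomic measures *)

Section AtomicMeasure.
Variables (R : realType) (n : nat) (w : nat -> {nonneg R}) (x : nat -> R[i]).

Definition atomic : {measure set (borelC R) -> \bar R} :=
  msum (fun j => mscale (w j) (dirac (x j : borelC R))) n.

Lemma integral_atomic_ge0 (g : R[i] -> R) :
  measurable_fun setT (g : borelC R -> R) -> (forall z, 0 <= g z) ->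
  (\int[atomic]_(z in [set: borelC R]) (g z)%:E =
     (\sum_(j < n) (w j)%:num * g (x j))%:E)%E.
Proof.
move=> mg g0; have mg' : measurable_fun setT (EFin \o (g : borelC R -> R)).
  exact/measurable_EFinP.
rewrite ge0_integral_measure_sum //; last by move=> z _; rewrite lee_fin.
rewrite -sumEFin; apply: eq_bigr => j _.
rewrite ge0_integral_mscale //; last by move=> z _; rewrite lee_fin.
by rewrite integral_dirac // diracT mul1e EFinM.
Qed.

Lemma integrable_atomic (g : R[i] -> R) :
  measurable_fun setT (g : borelC R -> R) ->
  atomic.-integrable setT (fun z : borelC R => (g z)%:E).
Proof.
move=> mg; apply/integrableP; split; first exact/measurable_EFinP.
rewrite (integral_atomic_ge0 (g := fun z => `|g z|)) ?ltry //.
exact: measurableT_comp.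
Qed.

(** Writing $g=(g+|g|)-|g|$ reduces a signed integrand to two nonnegative ones. *)
Lemma Rintegral_atomic (g : R[i] -> R) :
  measurable_fun setT (g : borelC R -> R) ->
  \int[atomic]_(z in [set: borelC R]) g z = \sum_(j < n) (w j)%:num * g (x j).
Proof.
move=> mg.
have mn : measurable_fun setT (fun z : borelC R => `|g z|).
  exact: measurableT_comp.
have mD : measurable_fun setT (fun z : borelC R => g z + `|g z|).
  exact: measurable_funD.
transitivity (\int[atomic]_(z in [set: borelC R]) ((g z + `|g z|) - `|g z|)).
  by apply: eq_Rintegral => z _; rewrite addrK.
rewrite RintegralB //; try exact: integrable_atomic.
rewrite /Rintegral (integral_atomic_ge0 (g := fun z => g z + `|g z|)) //; last first.
  by move=> z; have := ler_norm (- g z); rewrite normrN; lra.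
rewrite integral_atomic_ge0 //= -sumrB.
by apply: eq_bigr => j _; rewrite mulrDr addrK.
Qed.

End AtomicMeasure.

(** * Measurability of the monomials *)

Section MonomialMeasurability.
Variable R : realType.

Definition cmeasurable (f : R[i] -> R[i]) :=
  measurable_fun setT ((fun z => complex.Re (f z)) : borelC R -> R) /\
  measurable_fun setT ((fun z => complex.Im (f z)) : borelC R -> R).

Lemma cmeasurableM (f g : R[i] -> R[i]) :
  cmeasurable f -> cmeasurable g -> cmeasurable (fun z => f z * g z).
Proof.
move=> [fR fI] [gR gI]; split.
- rewrite (_ : (fun z => _) = fun z : borelC R =>
    complex.Re (f z) * complex.Re (g z) - complex.Im (f z) * complex.Im (g z)).
    by apply: measurable_funB; apply: measurable_funM.
  by apply/funext => z; case: (f z) (g z) => [? ?] [? ?].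
- rewrite (_ : (fun z => _) = fun z : borelC R =>
    complex.Re (f z) * complex.Im (g z) + complex.Im (f z) * complex.Re (g z)).
    by apply: measurable_funD; apply: measurable_funM.
  by apply/funext => z; case: (f z) (g z) => [? ?] [? ?].
Qed.

Lemma cmeasurableX (f : R[i] -> R[i]) n :
  cmeasurable f -> cmeasurable (fun z => f z ^+ n).
Proof.
move=> mf; elim: n => [|n IHn]; first by split; apply: measurable_cst.
by under eq_fun do rewrite exprS; exact: cmeasurableM.
Qed.

Lemma cmeasurable_monomial p q :
  cmeasurable (fun z : R[i] => z^* ^+ p * z ^+ q).
Proof.
apply: cmeasurableM; apply: cmeasurableX; last first.
  by split; [exact: measurable_borelC_Re | exact: measurable_borelC_Im].
split.
- rewrite (_ : (fun z => _) = @complex.Re R); first exact: measurable_borelC_Re.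
  by apply/funext => -[].
- rewrite (_ : (fun z => _) = fun z : borelC R => - complex.Im z).
    by apply: measurable_funN; exact: measurable_borelC_Im.
  by apply/funext => -[].
Qed.

End MonomialMeasurability.

Lemma represents_atomic (R : realType) (I : nat -> nat -> bool) (gamma : nat -> nat -> R[i])
    n (w : nat -> {nonneg R}) (x : nat -> R[i]) :
  (forall p q, I p q -> gamma p q =
     \sum_(j < n) (w j)%:num%:C * ((x j)^* ^+ p * x j ^+ q)) ->
  represents I gamma (atomic n w x).
Proof.
move=> gammaE p q /gammaE {gammaE} gpq f.
have [mR mI] := cmeasurable_monomial R p q.
split; try exact: integrable_atomic.
rewrite (Rintegral_atomic n w x mR) (Rintegral_atomic n w x mI) gpq.
elim: n {gpq} => [|n IHn]; first by rewrite !big_ord0.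
by rewrite !big_ord_recr /= IHn /f; case: ((x n)^* ^+ p * _) => a b; simpc.

Qed.

(** * Polynomial functions and positivity of the moment matrix *)

Section PolynomialFunctions.
Variable R : realType.
Implicit Types f g : R[i] -> R[i].

(** Coefficients are indexed like the rows of [moment_mx n], so they form a vector on which [psdmx]
    can be tested. *)
Definition polyfun n f := exists a : monom n -> R[i],
  forall z, f z = \sum_m a m * (z^* ^+ deg_zb m * z ^+ deg_z m).

Lemma deg_monom_of n p q : (p + q <= n)%N ->
  deg_zb (monom_of n p q) = p /\ deg_z (monom_of n p q) = q.
Proof.
move=> pqn; rewrite /deg_zb /deg_z /monom_of.
have pn : (p < n.+1)%N by rewrite ltnS (leq_trans (leq_addr q p)).
have qn : (q < n.+1)%N by rewrite ltnS (leq_trans (leq_addl p q)).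
by rewrite val_insubd /= !inordK // pqn /= !inordK.
Qed.

Lemma deg_monom_le n (m : monom n) : (deg_zb m + deg_z m <= n)%N.
Proof. exact: (valP m). Qed.

Lemma eq_polyfun n f g : f =1 g -> polyfun n f -> polyfun n g.
Proof. by move=> /funext ->. Qed.

Lemma polyfun_monomial n p q :
  (p + q <= n)%N -> polyfun n (fun z => z^* ^+ p * z ^+ q).
Proof.
move=> /deg_monom_of[pE qE].
exists (fun m => (m == monom_of n p q)%:R) => z.
rewrite (bigD1 (monom_of n p q)) //= eqxx mul1r pE qE big1 ?addr0 //.
by move=> m /negPf ->; rewrite mul0r.
Qed.

Lemma polyfunD n f g :
  polyfun n f -> polyfun n g -> polyfun n (fun z => f z + g z).
Proof.
move=> [a fE] [b gE]; exists (fun m => a m + b m) => z.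
by rewrite fE gE -big_split; apply: eq_bigr => m _; rewrite mulrDl.
Qed.

Lemma polyfunZ n c f : polyfun n f -> polyfun n (fun z => c * f z).
Proof.
move=> [a fE]; exists (fun m => c * a m) => z.
by rewrite fE mulr_sumr; apply: eq_bigr => m _; rewrite mulrA.
Qed.

Lemma polyfun_sum n (I : Type) (r : seq I) (F : I -> R[i] -> R[i]) :
  (forall i, polyfun n (F i)) -> polyfun n (fun z => \sum_(i <- r) F i z).
Proof.
move=> nF; elim: r => [|i r IHr].
  apply: (@eq_polyfun _ (fun z => 0 * (z^* ^+ 0 * z ^+ 0))).
    by move=> z; rewrite big_nil mul0r.
  by apply: polyfunZ; apply: polyfun_monomial.
by under eq_fun do rewrite big_cons; exact: polyfunD.
Qed.

Lemma polyfunM m n f g :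
  polyfun m f -> polyfun n g -> polyfun (m + n) (fun z => f z * g z).
Proof.
move=> [a fE] [b gE].
apply: (@eq_polyfun _ (fun z => \sum_i \sum_j
    a i * b j * (z^* ^+ (deg_zb i + deg_zb j) * z ^+ (deg_z i + deg_z j)))).
  move=> z; rewrite fE gE mulr_suml; apply: eq_bigr => i _.
  by rewrite mulr_sumr; apply: eq_bigr => j _; rewrite !exprD; ring.
apply: polyfun_sum => i; apply: polyfun_sum => j.
apply: polyfunZ; apply: polyfun_monomial.
by rewrite addnACA leq_add // deg_monom_le.
Qed.

Lemma polyfun_cst n c : polyfun n (fun=> c).
Proof.
apply: (@eq_polyfun _ (fun z => c * (z^* ^+ 0 * z ^+ 0))).
  by move=> z; rewrite !expr0 !mulr1.
by apply: polyfunZ; apply: polyfun_monomial.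
Qed.

(** On the coefficient vector of [f], the quadratic form of the moment matrix is the moment
    functional at $f\bar f$, here a sum over the points [x j]. The weights may be any complex
    numbers. *)
Lemma psd_atomic_ge0 d n (gamma : nat -> nat -> R[i]) (w x : 'I_n -> R[i]) f :
  psdmx (moment_mx d gamma) ->
  (forall p q, (p + q <= d + d)%N ->
     gamma p q = \sum_j w j * ((x j)^* ^+ p * x j ^+ q)) ->
  polyfun d f -> 0 <= \sum_j w j * (f (x j) * (f (x j))^*).
Proof.
move=> psd gammaE [a fE].
have := psd (\col_i a (enum_val i)); congr (0 <= _).
rewrite mxE.
pose G i k := \sum_j w j * (a k * ((x j)^* ^+ deg_zb k * x j ^+ deg_z k) *
  (a i * ((x j)^* ^+ deg_zb i * x j ^+ deg_z i))^*).
transitivity (\sum_k \sum_i G i k).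
  have bij := onW_bij predT (enum_val_bij (monom d)).
  rewrite [RHS](reindex _ bij); apply: eq_bigr => k _.
  rewrite !mxE mulr_suml [RHS](reindex _ bij); apply: eq_bigr => i _.
  rewrite !mxE /= gammaE; last first.
    by rewrite addnACA leq_add ?deg_monom_le // addnC deg_monom_le.
  rewrite mulr_sumr mulr_suml; apply: eq_bigr => j _.
  by rewrite !rmorphM !rmorphXn /= conjCK !exprD; ring.
under eq_bigr do rewrite exchange_big /=.
rewrite exchange_big /=; apply: eq_bigr => j _.
under eq_bigr do rewrite -mulr_sumr -mulr_sumr.
by rewrite -mulr_sumr -mulr_suml -rmorph_sum -fE.
Qed.

End PolynomialFunctions.

(** * Sequences annihilated by $P$, its conjugate and $h$ *)

Lemma mul_ii (R : realType) : 'i%C * 'i%C = -1 :> R[i].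
Proof. by rewrite -expr2 sqr_i. Qed.

Lemma conj_i (R : realType) : ('i%C)^* = - 'i%C :> R[i].
Proof. by apply/eqP; rewrite eq_complex /= oppr0 !eqxx. Qed.

Lemma conj_real (R : realType) (x : R) : (x%:C)^* = x%:C :> R[i].
Proof. by apply/eqP; rewrite eq_complex /= oppr0 !eqxx. Qed.

Section Annihilation.
Variables (R : realType) (t u : R).
Implicit Types (D : nat -> nat -> R[i]) (z c : R[i]).

Let T := t%:C.
Let U := u%:C.

(** [D p q] stands for the value of a functional at $\bar z^pz^q$; the clauses say that it kills all
    multiples of $P$ and of $\bar P$. Two clauses occur because [D] need not be Hermitian. *)
Definition P_recurrent D :=
  (forall p q, D p q.+3 = 'i%C * T * D p q.+1 + U * D p.+1 q) /\
  (forall p q, D p.+3 q = - ('i%C * T) * D p.+1 q + U * D p q.+1).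

(** The value at $\bar z^pz^qh$, with $h=i\bar zz^2+\bar z^2z-iuz-u\bar z$ expanded. *)
Definition h_moment D p q : R[i] :=
  'i%C * D p.+1 q.+2 + D p.+2 q.+1 - 'i%C * U * D p q.+1 - U * D p.+1 q.

(** This is the identity $(\bar z-iz)h=\bar zP+z\bar P$. *)
Lemma h_moment_shift D p q :
  P_recurrent D -> h_moment D p.+1 q = 'i%C * h_moment D p q.+1.
Proof. by rewrite /h_moment => -[rz rzb]; rewrite rz rzb; ring: (mul_ii R). Qed.

(** This is the identity $(z^2-i(t+u))h=(iz\bar z+\bar z^2-iu)P+u\bar P$. *)
Lemma h_moment_shift2 D p q : P_recurrent D ->
  h_moment D p q.+2 = 'i%C * (T + U) * h_moment D p q.
Proof. by rewrite /h_moment => -[rz rzb]; rewrite !rz rzb; ring: (mul_ii R). Qed.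

Lemma h_moment_eq0 D : P_recurrent D ->
  h_moment D 0 0 = 0 -> h_moment D 0 1 = 0 -> forall p q, h_moment D p q = 0.
Proof.
(* The second shift settles the row $p=0$ two steps at a time; the first shift then passes from row
   to row. *)
move=> rD h0 h1; have h0q q : h_moment D 0 q = 0.
  elim/ltn_ind: q => -[|[|q]] // IHq.
  by rewrite h_moment_shift2 // IHq ?mulr0 // ltnW.
by elim=> // p IHp q; rewrite h_moment_shift // IHp mulr0.
Qed.

Definition annihilated D := P_recurrent D /\ forall p q, h_moment D p q = 0.

Lemma annihilatedB D E :
  annihilated D -> annihilated E -> annihilated (fun p q => D p q - E p q).
Proof.
move=> [[rz rzb] hD] [[sz szb] hE]; split; first split=> p q.
- by rewrite rz sz; ring.
- by rewrite rzb szb; ring.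
- move=> p q; rewrite -(subrr 0) -[X in X - _](hD p q) -[X in _ - X](hE p q).
  by rewrite /h_moment; ring.
Qed.

Lemma annihilatedZ c D :
  annihilated D -> annihilated (fun p q => c * D p q).
Proof.
move=> [[rz rzb] hD]; split; first split=> p q.
- by rewrite rz; ring.
- by rewrite rzb; ring.
- by move=> p q; rewrite -(mulr0 c) -(hD p q) /h_moment; ring.
Qed.

Lemma annihilated_sum n (D : 'I_n -> nat -> nat -> R[i]) :
  (forall j, annihilated (D j)) -> annihilated (fun p q => \sum_j D j p q).
Proof.
move=> aD; split; first split=> p q.
- by rewrite !mulr_sumr -big_split; apply: eq_bigr => j _; case: (aD j) => -[].
- by rewrite !mulr_sumr -big_split; apply: eq_bigr => j _; case: (aD j) => -[].
- move=> p q; rewrite /h_moment !mulr_sumr -!sumrN -!big_split big1 //= => j _.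
  by rewrite -[RHS]((aD j).2 p q).
Qed.

Definition Pval z := z ^+ 3 - 'i%C * T * z - U * z^*.
Definition hval z :=
  'i%C * (z^* * z ^+ 2) + z^* ^+ 2 * z - 'i%C * U * z - U * z^*.

Lemma conj_Pval z :
  (Pval z)^* = z^* ^+ 3 + 'i%C * T * z^* - U * z.
Proof.
rewrite /Pval !(rmorphB, rmorphXn, rmorphM) /= conjCK.
by rewrite conj_i !conj_real; ring.
Qed.

Lemma annihilated_monomial z : Pval z = 0 -> hval z = 0 ->
  annihilated (fun p q => z^* ^+ p * z ^+ q).
Proof.
move=> Pz hz; have Pzb : z^* ^+ 3 + 'i%C * T * z^* - U * z = 0.
  by rewrite -conj_Pval Pz rmorph0.
have z3 : z ^+ 3 = 'i%C * T * z + U * z^*.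
  by apply/eqP; rewrite -subr_eq0 -Pz /Pval; apply/eqP; ring.
have zb3 : z^* ^+ 3 = - ('i%C * T) * z^* + U * z.
  by apply/eqP; rewrite -subr_eq0 -Pzb; apply/eqP; ring.
split; first split=> p q.
- by rewrite -addn3 exprD z3 !exprS; ring.
- by rewrite -addn3 exprD zb3 !exprS; ring.
- move=> p q; rewrite -(mulr0 (z^* ^+ p * z ^+ q)) -hz /h_moment /hval.
  by rewrite !exprS !expr0; ring.
Qed.

(* Modulo P, its conjugate and h, every monomial reduces to a combination of
   these. *)
Definition reduced_monomials : seq (nat * nat) :=
  [:: (0, 0); (0, 1); (1, 0); (0, 2); (1, 1); (2, 0); (1, 2)]%N.

Lemma annihilated_eq0 D : annihilated D ->
  {in reduced_monomials, forall m, D m.1 m.2 = 0} -> forall p q, D p q = 0.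
Proof.
move=> [[rz rzb] hD] D0.
have D00 := D0 (0, 0)%N isT; have D01 := D0 (0, 1)%N isT.
have D10 := D0 (1, 0)%N isT; have D02 := D0 (0, 2)%N isT.
have D11 := D0 (1, 1)%N isT; have D20 := D0 (2, 0)%N isT.
have D12 := D0 (1, 2)%N isT; rewrite /= in D00 D01 D10 D02 D11 D20 D12.
(* The relation $h=0$ gives $\bar z^2z$, and $zh=0$ with $z^3$ reduced gives $\bar z^2z^2$; this
   completes the nine monomials with both exponents at most 2. *)
have D21 : D 2%N 1%N = 0.
  by have := hD 0%N 0%N; rewrite /h_moment D12 D01 D10 !mulr0 !subr0 add0r.
have D22 : D 2%N 2%N = 0.
  have := hD 0%N 1%N; rewrite /h_moment rz D11 D20 D02.
  by rewrite !(mulr0, addr0) !subr0 add0r.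
(* The recurrences lower the total degree by two as soon as one exponent reaches 3. *)
move=> p q; have [n] := ubnP (p + q)%N; elim: n p q => // n IHn p q.
rewrite ltnS => pqn; case: q pqn => [|[|[|q]]] pqn; last first.
- by rewrite rz !IHn ?mulr0 ?addr0 //; lia.
- case: p pqn => [|[|[|p]]] // pqn.
  by rewrite rzb !IHn ?mulr0 ?addr0 //; lia.
- case: p pqn => [|[|[|p]]] // pqn.
  by rewrite rzb !IHn ?mulr0 ?addr0 //; lia.
- case: p pqn => [|[|[|p]]] // pqn.
  by rewrite rzb !IHn ?mulr0 ?addr0 //; lia.
Qed.

End Annihilation.

(** * The zero set of $P$ in rotated coordinates *)

(* [rotX z] and [rotY z] are real and imaginary parts of [2 z / (1 + i)]: in these
   coordinates the zero set of [P] is symmetric about both axes. *)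
Section RotatedCoordinates.
Variables (R : realType) (t u : R).

Definition rotX (z : R[i]) : R := complex.Re z + complex.Im z.
Definition rotY (z : R[i]) : R := complex.Im z - complex.Re z.
Definition ofXY (m : R * R) : R[i] :=
  Complex ((m.1 - m.2) / 2) ((m.1 + m.2) / 2).

Lemma rotX_ofXY m : rotX (ofXY m) = m.1. Proof. by rewrite /rotX /=; field. Qed.
Lemma rotY_ofXY m : rotY (ofXY m) = m.2. Proof. by rewrite /rotY /=; field. Qed.

(** With $w=X+iY$ and $z=(1+i)w/2$ one has $P=\frac{i(1+i)}4(w^3-2tw+2u\bar w)$; the two equations
    are the real and imaginary parts of the bracket. *)
Lemma Pval_eq0P z : Pval t u z = 0 <->
  rotX z ^+ 3 - 3 * rotX z * rotY z ^+ 2 = 2 * (t - u) * rotX z /\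
  3 * rotX z ^+ 2 * rotY z - rotY z ^+ 3 = 2 * (t + u) * rotY z.
Proof.
case: z => x y.
have -> : Pval t u (Complex x y) = Complex
    (x ^+ 3 - 3 * x * y ^+ 2 + t * y - u * x)
    (3 * x ^+ 2 * y - y ^+ 3 - t * x + u * y).
  rewrite /Pval; apply/eqP; rewrite eq_complex !exprS !expr0 /=.
  by apply/andP; split; apply/eqP; ring.
rewrite /rotX /rotY /=; split => [[P1 P2]|[P1 P2]].
  split; first by rewrite !exprS !expr0 in P1 P2 *; lra.
  by rewrite !exprS !expr0 in P1 P2 *; lra.
apply/eqP; rewrite eq_complex /=; apply/andP; split; apply/eqP;
  by rewrite !exprS !expr0 in P1 P2 *; lra.
Qed.

(** For $z=x+iy$ one has $h=(1+i)(x-y)(x^2+y^2-u)$ and $X^2+Y^2=2|z|^2$: the zero set is a line and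
    a circle. *)
Lemma hval_eq0P z : hval u z = 0 <-> rotY z * (rotX z ^+ 2 + rotY z ^+ 2 - 2 * u) = 0.
Proof.
case: z => x y.
have -> : hval u (Complex x y) = Complex ((x - y) * (x ^+ 2 + y ^+ 2 - u))
   ((x - y) * (x ^+ 2 + y ^+ 2 - u)).
  rewrite /hval; apply/eqP; rewrite eq_complex !exprS !expr0 /=.
  by apply/andP; split; apply/eqP; ring.
rewrite /rotX /rotY /=; split => [[+ _]|Yh].
  by rewrite !exprS !expr0; lra.
apply/eqP; rewrite eq_complex /= andbb; apply/eqP; move: Yh.
by rewrite !exprS !expr0; lra.
Qed.

(** Off the line $Y=0$, a zero of $P$ has $X\ne0$ because $t+u>0$. Dividing the two equations by $Y$
    and $X$ and subtracting then yields the circle $X^2+Y^2=2u$. *)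
Lemma hval_eq0 z : u < t -> t < 2 * u -> Pval t u z = 0 -> hval u z = 0.
Proof.
move=> ut tu /Pval_eq0P[P1 P2]; apply/hval_eq0P.
have [->|Y0] := eqVneq (rotY z) 0; first by rewrite mul0r.
have {}P2 : 3 * rotX z ^+ 2 - rotY z ^+ 2 = 2 * (t + u).
  by apply: (mulIf Y0); rewrite -P2; ring.
have [X0|X0] := eqVneq (rotX z) 0.
  by have := sqr_ge0 (rotY z); move: P2; rewrite X0 expr0n /=; lra.
have {}P1 : rotX z ^+ 2 - 3 * rotY z ^+ 2 = 2 * (t - u).
  by apply: (mulIf X0); rewrite -P1; ring.
by rewrite (_ : _ - _ = 0) ?mulr0 //; lra.
Qed.

Definition XYpolyfun n (g : R -> R -> R) :=
  polyfun n (fun z => (g (rotX z) (rotY z))%:C).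

Lemma XYpolyfunM m n g k : XYpolyfun m g -> XYpolyfun n k ->
  XYpolyfun (m + n) (fun a b => g a b * k a b).
Proof.
by move=> mg nk; apply: eq_polyfun (polyfunM mg nk) => z /=; rewrite rmorphM.
Qed.

Lemma XYpolyfunD n g k : XYpolyfun n g -> XYpolyfun n k ->
  XYpolyfun n (fun a b => g a b + k a b).
Proof.
by move=> mg nk; apply: eq_polyfun (polyfunD mg nk) => z /=; rewrite rmorphD.
Qed.

Lemma XYpolyfun_cst n c : XYpolyfun n (fun _ _ => c).
Proof. exact: polyfun_cst. Qed.

Lemma XYpolyfun_X n : (0 < n)%N -> XYpolyfun n (fun x _ => x).
Proof.
move=> n0; apply: (@eq_polyfun _ _ (fun z : R[i] =>
   Complex (1 / 2) (- 1 / 2) * (z^* ^+ 0 * z ^+ 1)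
   + Complex (1 / 2) (1 / 2) * (z^* ^+ 1 * z ^+ 0))).
  move=> [x y]; apply/eqP; rewrite eq_complex !expr1 !expr0 /rotX /=.
  by apply/andP; split; apply/eqP; field.
by apply: polyfunD; apply: polyfunZ; apply: polyfun_monomial.
Qed.

Lemma XYpolyfun_Y n : (0 < n)%N -> XYpolyfun n (fun _ y => y).
Proof.
move=> n0; apply: (@eq_polyfun _ _ (fun z : R[i] =>
   Complex (- 1 / 2) (- 1 / 2) * (z^* ^+ 0 * z ^+ 1)
   + Complex (- 1 / 2) (1 / 2) * (z^* ^+ 1 * z ^+ 0))).
  move=> [x y]; apply/eqP; rewrite eq_complex !expr1 !expr0 /rotY /=.
  by apply/andP; split; apply/eqP; field.
by apply: polyfunD; apply: polyfunZ; apply: polyfun_monomial.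
Qed.

End RotatedCoordinates.

(** * The seven zeros of $P$ and cubics separating them *)

Section Nodes.
Variables (R : realType) (t u : R) (ut : u < t) (t2u : t < 2 * u).

(** The nonzero zeros with $Y=0$ have $X^2=A^2$. Those off this axis solve $3X^2-Y^2=2(t+u)$ and
    $X^2-3Y^2=2(t-u)$, that is $X^2=B^2$ and $Y^2=C^2$. The bounds $u<t<2u$ make all three radicands
    positive. *)
Let A : R := Num.sqrt (2 * (t - u)).
Let B : R := Num.sqrt (t / 2 + u).
Let C : R := Num.sqrt (u - t / 2).

Let A0 : 0 < A. Proof. by rewrite sqrtr_gt0; move: ut; lra. Qed.
Let B0 : 0 < B. Proof. by rewrite sqrtr_gt0; move: ut t2u; lra. Qed.
Let C0 : 0 < C. Proof. by rewrite sqrtr_gt0; move: t2u; lra. Qed.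
Let AA : A * A = 2 * (t - u).
Proof. by rewrite -expr2 sqr_sqrtr //; move: ut; lra. Qed.
Let BB : B * B = t / 2 + u.
Proof. by rewrite -expr2 sqr_sqrtr //; move: ut t2u; lra. Qed.
Let CC : C * C = u - t / 2.
Proof. by rewrite -expr2 sqr_sqrtr //; move: t2u; lra. Qed.

Definition nodes : seq (R * R) :=
  [:: (0, 0); (A, 0); (- A, 0); (B, C); (B, - C); (- B, C); (- B, - C)].

(** The default $(0,0)$ is itself a zero of $P$, so [node_zero] needs no bound on [j]. *)
Definition node (j : nat) : R[i] := ofXY (nth (0, 0) nodes j).

Lemma node_zero j : Pval t u (node j) = 0 /\ hval u (node j) = 0.
Proof.
suff Pj : Pval t u (node j) = 0 by split=> //; exact: hval_eq0 Pj.
apply/Pval_eq0P; rewrite rotX_ofXY rotY_ofXY; rewrite !exprS !expr0 !mulr1.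
(* These equalities lower the cubic products of [A], [B], [C], after which [lra] can treat the
   remaining products as atoms. *)
have AAA : A * (A * A) = 2 * (t - u) * A by rewrite AA mulrC.
have BBB : B * (B * B) = (t / 2 + u) * B by rewrite BB mulrC.
have CCC : C * (C * C) = (u - t / 2) * C by rewrite CC mulrC.
have BCC : B * (C * C) = (u - t / 2) * B by rewrite CC mulrC.
have BBC : (B * B) * C = (t / 2 + u) * C by rewrite BB.
by case: j => [|[|[|[|[|[|[|j]]]]]]] /=; rewrite /nodes ?nth_nil /=; split; lra.
Qed.

Lemma node_separated (j : 'I_7) : exists f : R[i] -> R[i],
  [/\ polyfun 3 f, f (node j) != 0 & forall k : 'I_7, k != j -> f (node k) = 0].
Proof.
suff [g g3 [gj gk]] : exists2 g : R -> R -> R, XYpolyfun 3 g &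
    let v k := g (nth (0, 0) nodes k).1 (nth (0, 0) nodes k).2 in
    v j != 0 /\ forall k : 'I_7, k != j -> v k = 0.
  exists (fun z => (g (rotX z) (rotY z))%:C); rewrite rotX_ofXY rotY_ofXY; split=> //.
    by rewrite eq_complex /= eqxx andbT.
  by move=> k /gk; rewrite rotX_ofXY rotY_ofXY => ->.
have [AE BE CE] := And3 AA BB CC.
(* Zero on the lines $Y=0$, $Y=-c$ and $X=-b$: for $b=\pm B$ and $c=\pm C$ only the node $(b,c)$
   survives. *)
pose circle b c x y : R := y * (y + c) * (x + b).
have circle3 b c : XYpolyfun 3 (circle b c).
  apply: (@XYpolyfunM _ 2 1); first apply: (@XYpolyfunM _ 1 1).
  - exact: XYpolyfun_Y.
  - by apply: XYpolyfunD; [exact: XYpolyfun_Y | exact: XYpolyfun_cst].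
  - by apply: XYpolyfunD; [exact: XYpolyfun_X | exact: XYpolyfun_cst].
(* The lines $CX=\pm BY$ carry the origin and the four off-axis nodes; the last factor removes
   $(-a,0)$. *)
pose axis a x y : R := (C * x + B * y) * (C * x + - B * y) * (x + a).
have axis3 a : XYpolyfun 3 (axis a).
  have lin (c d : R) : XYpolyfun 1 (fun x y => c * x + d * y).
    apply: XYpolyfunD; apply: (@XYpolyfunM _ 0 1); try exact: XYpolyfun_cst.
      exact: XYpolyfun_X.
    exact: XYpolyfun_Y.
  apply: (@XYpolyfunM _ 2 1); first by apply: (@XYpolyfunM _ 1 1); exact: lin.
  by apply: XYpolyfunD; [exact: XYpolyfun_X | exact: XYpolyfun_cst].
(* The equation $X^2-3Y^2=2(t-u)$ holds at every node but the origin. *)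
pose origin x y : R := x * x + (- 3 * (y * y) + - (A * A)).
have origin3 : XYpolyfun 3 origin.
  apply: XYpolyfunD.
    by apply: (@XYpolyfunM _ 1 2); exact: XYpolyfun_X.
  apply: XYpolyfunD; last exact: XYpolyfun_cst.
  apply: (@XYpolyfunM _ 0 3); first exact: XYpolyfun_cst.
  by apply: (@XYpolyfunM _ 1 2); exact: XYpolyfun_Y.
pose sep j := nth origin [:: origin; axis A; axis (- A);
  circle B C; circle B (- C); circle (- B) C; circle (- B) (- C)] j.
exists (sep j).
  by rewrite /sep; case: j => [[|[|[|[|[|[|[|j]]]]]]] hj] //=.
have [An0 Bn0 Cn0] : [/\ A != 0, B != 0 & C != 0] by rewrite !lt0r_neq0.
have AA_neq0 : A * A != 0 by rewrite mulf_neq0.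
have dn0 (a : R) : a != 0 -> a + a != 0 by rewrite -mulr2n mulrn_eq0.
split.
  by rewrite /sep; case: j => [[|[|[|[|[|[|[|j]]]]]]] hj] //=;
    rewrite /origin /axis /circle ?(mulr0, addr0, add0r, oppr_eq0) //;
    repeat (apply: mulf_neq0); rewrite ?(mulr0, mulrN, addr0, add0r, oppr_eq0) ?dn0 ?oppr_eq0 ?mulf_neq0.
move=> k; rewrite -(inj_eq val_inj) /sep /=.
by case: j => [[|[|[|[|[|[|[|j]]]]]]] hj] //=;
  case: k => [[|[|[|[|[|[|[|k]]]]]]] hk] //= _; rewrite /origin /axis /circle;
  first [by rewrite !(mulr0, addr0, add0r, addNr, addrN, mul0r) | by ring | lra].
Qed.

End Nodes.

(** * Nonnegative weights at the zeros *)

Section Quadrature.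
Variables (R : realType) (t u : R) (ut : u < t) (t2u : t < 2 * u).

Let e (j : 'I_7) p q : R[i] := (node t u j)^* ^+ p * node t u j ^+ q.

Let annihilated_e j : annihilated t u (e j).
Proof.
have [Pj hj] := node_zero ut t2u j; exact: annihilated_monomial Pj hj.
Qed.

Let b (m : 'I_7) := nth (0, 0)%N reduced_monomials m.

Let basisP (D : nat -> nat -> R[i]) : annihilated t u D ->
  (forall m, D (b m).1 (b m).2 = 0) -> forall p q, D p q = 0.
Proof.
move=> aD D0; apply: annihilated_eq0 aD _ => m /(nthP (0, 0)%N)[i i7 <-].
exact: (D0 (Ordinal i7)).
Qed.

(* A sequence killed by P, its conjugate and h is determined by its values on
   [reduced_monomials], so separating the nodes shows that the evaluations at
   them span all such sequences. *)
Lemma annihilated_node_combination (gamma : nat -> nat -> R[i]) :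
  annihilated t u gamma -> exists w : 'I_7 -> R[i],
    forall p q, gamma p q = \sum_j w j * e j p q.
Proof.
move=> agamma; pose E : 'M[R[i]]_7 := \matrix_(j, m) e j (b m).1 (b m).2.
have acomb (v : 'I_7 -> R[i]) : annihilated t u (fun p q => \sum_j v j * e j p q).
  by apply: annihilated_sum => j; exact/annihilatedZ/annihilated_e.
have EE (v : 'rV_7) m : (v *m E) 0 m = \sum_j v 0 j * e j (b m).1 (b m).2.
  by rewrite mxE; apply: eq_bigr => j _; rewrite mxE.
(* A row killed by [E] gives a node combination that vanishes on the reduced monomials, hence
   everywhere; applied to the cubic separating node [j], it isolates the coefficient at [j]. *)
have E_unit : E \in unitmx.
  rewrite -row_free_unit; apply: inj_row_free => v vE0.
  have v0 : forall p q, \sum_j v 0 j * e j p q = 0.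
    by apply: (basisP (acomb (v 0))) => m; rewrite -EE vE0 mxE.
  apply/rowP => j; rewrite mxE.
  have [f [[a fE] fj fk]] := node_separated ut t2u j.
  have : \sum_k v 0 k * f (node t u k) = 0.
    under eq_bigr do rewrite fE mulr_sumr.
    rewrite exchange_big big1 //= => m _.
    transitivity (a m * \sum_k v 0 k * e k (deg_zb m) (deg_z m)); last first.
      by rewrite v0 mulr0.
    by rewrite mulr_sumr; apply: eq_bigr => k _; rewrite mulrCA.
  rewrite (bigD1 j) //= big1 ?addr0 => [/eqP|k kj]; last by rewrite fk ?mulr0.
  by rewrite mulf_eq0 (negPf fj) orbF => /eqP.
(* These weights match [gamma] on the reduced monomials; the difference is annihilated, so it
   vanishes identically. *)
pose w := \row_m gamma (b m).1 (b m).2 *m invmx E.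
exists (w 0) => p q; apply/eqP; rewrite -subr_eq0; apply/eqP.
move: p q; apply: (basisP (annihilatedB agamma (acomb (w 0)))) => m.
by rewrite -EE mulmxKV // mxE subrr.
Qed.

Lemma annihilated_psd_representing_measure (gamma : nat -> nat -> R[i]) :
  annihilated t u gamma -> psdmx (moment_mx 3 gamma) ->
  has_representing_measure (fun _ _ => true) gamma.
Proof.
move=> /annihilated_node_combination[w gammaE] psd.
have w_ge0 j : 0 <= w j.
  have [f [f3 fj fk]] := node_separated ut t2u j.
  have := psd_atomic_ge0 psd (fun p q _ => gammaE p q) f3.
  rewrite (bigD1 j) //= big1 ?addr0 => [|k kj]; last by rewrite fk ?mul0r ?mulr0.
  by rewrite pmulr_lge0 // -normCK exprn_gt0 // normr_gt0.
(* Being nonnegative in [R[i]], [w j] is real, so $|\operatorname{Re}w_j|$ is [w j] itself; the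
   absolute value only supplies the type of nonnegative reals. *)
pose wn (k : nat) : {nonneg R} :=
  NngNum (normr_ge0 (complex.Re (w (inord k)))).
exists (atomic 7 wn (node t u)); apply: represents_atomic => p q _.
rewrite gammaE; apply: eq_bigr => j _; rewrite /= inord_val.
congr (_ * _); have := w_ge0 j; case: (w j) => a c /=.
by rewrite lecE /= => /andP[/eqP -> a0]; rewrite ger0_norm.
Qed.

End Quadrature.

(** * Measures representing $\omega$ *)

Section Support.
Variables (R : realType) (t u : R) (omega : nat -> nat -> R[i]).
Variable mu : {measure set (borelC R) -> \bar R}.

(** Lists of coefficients and exponents turn the integral of an explicit polynomial into an explicit
    combination of moments. *)
Lemma represents_combination (I : nat -> nat -> bool) (r : seq (R[i] * (nat * nat))) :
  represents I omega mu -> all (fun m => I m.2.1 m.2.2) r ->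
  has_cintegral mu (fun z => \sum_(m <- r) m.1 * (z^* ^+ m.2.1 * z ^+ m.2.2))
    (\sum_(m <- r) m.1 * omega m.2.1 m.2.2).
Proof.
move=> rep; elim: r => [_|m r IHr /= /andP[Im Ir]].
  under eq_fun do rewrite big_nil; rewrite big_nil; split.
  - exact: integrable0.
  - exact: integrable0.
  - by rewrite /Rintegral integral0.
under eq_fun do rewrite big_cons; rewrite big_cons.
by apply: has_cintegralD (IHr Ir); apply: has_cintegralZ; exact: rep.
Qed.

(* The recurrence makes the integral of |P|^2 vanish, so that the measure is
   carried by the zero set of P. *)
Lemma represents_h_moment : u < t -> t < 2 * u ->
  represents (fun p q => p + q <= 6)%N omega mu ->
  (forall l k, (l + k <= 3)%N -> omega l k.+3 =
     'i%C * t%:C * omega l k.+1 + u%:C * omega l.+1 k) ->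
  h_moment u omega 0 0 = 0 /\ h_moment u omega 0 1 = 0.
Proof.
move=> ut t2u rep rec.
have P2 : has_cintegral mu (fun z => `|Pval t u z| ^+ 2) 0.
  pose c := 'i%C * t%:C : R[i].
  (* The nine terms of $(z^3-cz-u\bar z)(\bar z^3+c\bar z-uz)$, where $\bar c=-c$. *)
  apply: (eq_has_cintegral _ _ (represents_combination (r :=
    [:: (1, (3, 3)%N); (c, (1, 3)%N); (- u%:C, (0, 4)%N); (- c, (3, 1)%N);
        (- c ^+ 2, (1, 1)%N); (c * u%:C, (0, 2)%N); (- u%:C, (4, 0)%N);
        (- (u%:C * c), (2, 0)%N); (u%:C ^+ 2, (1, 1)%N)]) rep isT)).
    move=> z; rewrite !big_cons big_nil /= normCK conj_Pval /Pval -/c.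
    by rewrite !exprS !expr0; ring.
  (* In $P\bar P=\bar z^3P+c\bar zP-uzP$ each summand integrates to zero, by the recurrence at
     $(3,0)$, $(1,0)$ and $(0,1)$. *)
  rewrite !big_cons big_nil /= (rec 3%N 0%N) // (rec 1%N 0%N) // (rec 0%N 1%N) //.
  by rewrite -/c; ring.
split.
- apply: (has_cintegral_ae0 P2 (g := hval u)) => [z|]; first exact: hval_eq0.
  apply: (eq_has_cintegral _ _ (represents_combination (r :=
    [:: ('i%C, (1, 2)%N); (1, (2, 1)%N); (- ('i%C * u%:C), (0, 1)%N);
        (- u%:C, (1, 0)%N)]) rep isT)).
    by move=> z; rewrite !big_cons big_nil /hval /= !exprS !expr0; ring.
  by rewrite !big_cons big_nil /h_moment /=; ring.
- apply: (has_cintegral_ae0 P2 (g := fun z => z * hval u z)) => [z Pz|].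
    by rewrite (hval_eq0 ut t2u Pz) mulr0.
  apply: (eq_has_cintegral _ _ (represents_combination (r :=
    [:: ('i%C, (1, 3)%N); (1, (2, 2)%N); (- ('i%C * u%:C), (0, 2)%N);
        (- u%:C, (1, 1)%N)]) rep isT)).
    by move=> z; rewrite !big_cons big_nil /hval /= !exprS !expr0; ring.
  by rewrite !big_cons big_nil /h_moment /=; ring.
Qed.

End Support.

(** * Coefficients of polynomials in $z$ and $\bar z$ *)

Section BivariatePolynomials.
Variable R : realType.
Implicit Types (g : zpoly R) (gamma : nat -> nat -> R[i]).

Lemma sum_select (V : nmodType) n (Q : nat -> nat -> bool) (F : nat -> nat -> V) l0 k0 :
  (l0 < n)%N -> (k0 < n)%N -> Q l0 k0 ->
  \sum_(l < n) \sum_(k < n | Q l k) F l k *+ ((l0 == l) && (k0 == k)) = F l0 k0.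
Proof.
move=> l0n k0n Q0.
have neqF m i (im : (i < m)%N) (j : 'I_m) : j != Ordinal im -> (i == j) = false.
  by move=> ji; apply/negbTE; rewrite eq_sym.
rewrite (bigD1 (Ordinal l0n)) //= [X in _ + X]big1 => [|l /neqF ll0].
  rewrite addr0 (bigD1 (Ordinal k0n)) //= !eqxx big1 ?addr0 // => k /andP[_ /neqF kk0].
  by rewrite kk0 andbF.
by apply: big1 => k _; rewrite ll0.
Qed.

Lemma coef_term (c : R[i]) l0 k0 l k :
  (cpoly c * Zbar ^+ l0 * Z ^+ k0)`_l`_k = c *+ ((l == l0) && (k == k0)).
Proof.
have -> : cpoly c * Zbar ^+ l0 * Z ^+ k0 = (c%:P * 'X^k0)%:P * 'X^l0 :> zpoly R.
  by rewrite /cpoly /Zbar /Z polyCM rmorphXn /= mulrAC.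
rewrite coefCM coefXn; case: (l == l0); last by rewrite mulr0 coef0.
by rewrite mulr1 coefCM coefXn mulr_natr.
Qed.

Lemma LambdaD d gamma g1 g2 :
  Lambda d gamma (g1 + g2) = Lambda d gamma g1 + Lambda d gamma g2.
Proof.
rewrite /Lambda -big_split; apply: eq_bigr => l _.
by rewrite -big_split; apply: eq_bigr => k _ /=; rewrite !coefD mulrDl.
Qed.

Lemma Lambda_term d gamma c l k : (l + k <= d)%N ->
  Lambda d gamma (cpoly c * Zbar ^+ l * Z ^+ k) = c * gamma l k.
Proof.
move=> lkd; rewrite -(@sum_select _ d.+1 (fun l k => l + k <= d)%N
  (fun l k => c * gamma l k)) ?ltnS ?(leq_trans _ lkd) ?leq_addr ?leq_addl //.
apply: eq_bigr => i _; apply: eq_bigr => j _.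
by rewrite coef_term mulrnAl [(i == l :> nat)]eq_sym [(j == k :> nat)]eq_sym.
Qed.

(** [charpolys] sums over actual sizes and [Lambda] over a fixed triangle; the terms in which they
    differ vanish. *)
Lemma sum_coef_Lambda d (gamma : nat -> nat -> R[i]) g :
  (forall l k, (d < l + k)%N -> g`_l`_k = 0) ->
  \sum_(l < size g) \sum_(k < size g`_l) g`_l`_k * gamma l k = Lambda d gamma g.
Proof.
move=> gd; rewrite /Lambda.
have row0 l : (d < l)%N -> g`_l = 0.
  move=> dl; apply/polyP => k; rewrite coef0 gd //.
  exact: leq_trans dl (leq_addr _ _).
have sz : (size g <= d.+1)%N by apply/leq_sizeP => l; exact: row0.
rewrite (big_ord_widen _ (fun l => \sum_(k < size g`_l) g`_l`_k * gamma l k) sz).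
rewrite big_mkcond; apply: eq_bigr => l _.
have szl : (size (g`_l)%R <= d.+1)%N.
  apply/leq_sizeP => k dk; apply: gd; exact: leq_trans dk (leq_addl _ _).
rewrite (big_ord_widen _ (fun k => g`_l`_k * gamma l k) szl) big_mkcond.
rewrite [RHS]big_mkcond; case: ltnP => [_|lg].
  apply: eq_bigr => k _; case: ltnP => [_|kg]; case: leqP => // lkd.
    by rewrite gd // mul0r.
  by rewrite [X in X * _]nth_default ?mul0r.
rewrite big1 // => k _; rewrite [g`_l]nth_default // coef0 mul0r; exact: if_same.
Qed.

End BivariatePolynomials.

(** * The RDIS and the characteristic polynomial $h$ *)

Lemma cpoly1 (R : realType) : cpoly 1 = 1 :> zpoly R.
Proof. by rewrite /cpoly !polyC1. Qed.

(** Comparing coefficients in [is_RDIS] determines [a] below total degree 3; Hermitian symmetry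
    turns the conjugate of the recurrence into the second clause of [P_recurrent]. *)
Lemma RDIS3_recurrence (R : realType) (t u : R) init gamma :
  is_RDIS 3 init
    (Z ^+ 3 - cpoly ('i%C * t%:C) * Z - cpoly u%:C * Zbar) gamma ->
  [/\ forall p q, (p <= q < 3)%N -> gamma p q = init p q,
      forall p q, gamma q p = (gamma p q)^* & P_recurrent t u gamma].
Proof.
case=> a PE [ini herm rec]; split=> //.
have aE l k : (l + k < 3)%N ->
    a l k = ('i%C * t%:C) *+ ((l == 0%N) && (k == 1%N))
            + u%:C *+ ((l == 1%N) && (k == 0%N)).
  move=> lk; have := congr1 (fun g : zpoly R => g`_l`_k) PE.
  have PE' (A : comNzRingType) (c1 c2 z w : A) : z ^+ 3 - c1 * z - c2 * w =
      1 * w ^+ 0 * z ^+ 3 - c1 * w ^+ 0 * z ^+ 1 - c2 * w ^+ 1 * z ^+ 0 by ring.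
  have rE' (A : comNzRingType) (z w s : A) : z ^+ 3 - s = 1 * w ^+ 0 * z ^+ 3 - s.
    by ring.
  rewrite /rdis_poly [LHS](congr1 (fun g : zpoly R => g`_l`_k) (PE' _ _ _ Z Zbar)).
  rewrite [RHS](congr1 (fun g : zpoly R => g`_l`_k) (rE' _ Z Zbar _)) -cpoly1.
  rewrite !coefB !coef_term coef_sum coef_sum.
  under eq_bigr do rewrite coef_sum coef_sum.
  under eq_bigr do under eq_bigr do rewrite coef_term.
  rewrite (@sum_select _ 3 (fun l k => l + k < 3)%N a) //; try lia.
  by move/eqP; rewrite -addrA -opprD => /eqP/addrI/oppr_inj <-.
have rz p q : gamma p q.+3 = 'i%C * t%:C * gamma p q.+1 + u%:C * gamma p.+1 q.
  rewrite -addn3 rec; under eq_bigr do rewrite big_mkcond /=.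
  rewrite !big_ord_recl !big_ord0 /= !aE // !add0r !addr0 /bump /=.
  by rewrite !mulr0n !mulr1n !(mul0r, add0r, addr0) ?addn0 ?addn1.
split=> // p q; rewrite herm rz rmorphD !rmorphM /= -!herm.
by rewrite conj_i !conj_real mulNr.
Qed.

Section CharacteristicPolynomial.
Variables (R : realType) (u : R).

Let h : zpoly R :=
  cpoly 'i%C * (Z - cpoly 'i%C * Zbar) * (Z * Zbar - cpoly u%:C).

Let hE : h = cpoly 'i%C * Zbar ^+ 1 * Z ^+ 2 + cpoly 1 * Zbar ^+ 2 * Z ^+ 1
  + cpoly (- ('i%C * u%:C)) * Zbar ^+ 0 * Z ^+ 1
  + cpoly (- u%:C) * Zbar ^+ 1 * Z ^+ 0.
Proof.
have E (A : comNzRingType) (c v z w : A) : c * c = -1 ->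
    c * (z - c * w) * (z * w - v) =
    c * w ^+ 1 * z ^+ 2 + 1 * w ^+ 2 * z ^+ 1 + - (c * v) * w ^+ 0 * z ^+ 1
    + - v * w ^+ 1 * z ^+ 0.
  by move=> c2; ring: c2.
have ii : cpoly 'i%C * cpoly 'i%C = -1 :> zpoly R.
  by rewrite /cpoly -!polyCM mul_ii !polyCN !polyC1.
by rewrite /h (E _ _ _ Z Zbar ii) cpoly1 /cpoly !polyCN !polyCM.
Qed.

Lemma Lambda_h d (gamma : nat -> nat -> R[i]) : (3 <= d)%N ->
  Lambda d gamma h = h_moment u gamma 0 0.
Proof.
by move=> d3; rewrite hE !LambdaD !Lambda_term ?(leq_trans _ d3) // /h_moment; ring.
Qed.

Lemma Lambda_Zh d (gamma : nat -> nat -> R[i]) : (4 <= d)%N ->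
  Lambda d gamma (Z * h) = h_moment u gamma 0 1.
Proof.
move=> d4; have ZM (c : R[i]) l k :
    Z * (cpoly c * Zbar ^+ l * Z ^+ k) = cpoly c * Zbar ^+ l * Z ^+ k.+1.
  by rewrite exprS mulrCA.
rewrite hE !mulrDr !ZM !LambdaD !Lambda_term ?(leq_trans _ d4) // /h_moment.
by ring.
Qed.

Lemma charpolys_h (gamma : nat -> nat -> R[i]) :
  charpolys gamma h <-> forall p q, h_moment u gamma p q = 0.
Proof.
have hd l k : (3 < l + k)%N -> h`_l`_k = 0.
  move=> lk; rewrite hE !coefD !coef_term.
  do 4?[case: andP => [[/eqP l0 /eqP k0]|_]; first by rewrite l0 k0 in lk].
  by rewrite !mulr0n !addr0.
have charE p q : \sum_(l < size h) \sum_(k < size h`_l)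
    h`_l`_k * gamma (p + l)%N (q + k)%N = h_moment u gamma p q.
  (* The sum at $(p,q)$ is [Lambda 3] of the sequence shifted by $(p,q)$. *)
  rewrite (sum_coef_Lambda (fun l k => gamma (p + l)%N (q + k)%N) hd).
  by rewrite Lambda_h // /h_moment !addn0 !addn1 !addn2.
by split=> gh p q; have := gh p q; rewrite /= charE.
Qed.

End CharacteristicPolynomial.

(** * Column relations of $M(\omega)(3)$ *)

Section MomentMatrix.
Variables (R : realType) (t u : R) (omega : nat -> nat -> R[i]).

(** A row monomial enters through its conjugate, hence the exchange of [l] and [k] in [monom_of]. *)
Lemma moment_col_entry l k (i := enum_rank (monom_of 3 k l)) p q :
  (l + k <= 3)%N -> (p + q <= 3)%N ->
  moment_col 3 omega p q i 0 = omega (p + l)%N (q + k)%N.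
Proof.
move=> lk pq; rewrite moment_colE // enum_rankK.
by have [-> ->] : deg_zb (monom_of 3 k l) = k /\ deg_z (monom_of 3 k l) = l
  by apply: deg_monom_of; rewrite addnC.
Qed.

Lemma moment_col_recurrence :
  moment_col 3 omega 0 3 = ('i%C * t%:C) *: moment_col 3 omega 0 1
    + u%:C *: moment_col 3 omega 1 0 ->
  forall l k, (l + k <= 3)%N -> omega l k.+3 =
    'i%C * t%:C * omega l k.+1 + u%:C * omega l.+1 k.
Proof.
move=> col l k lk.
have := congr1 (fun v : 'cV_#|monom 3| => v (enum_rank (monom_of 3 k l)) 0) col.
by rewrite [RHS]mxE [X in _ = X + _]mxE [X in _ = _ + X]mxE !moment_col_entry.
Qed.

Lemma moment_col_h :
  moment_col 3 omega 1 2 - 'i%C *: moment_col 3 omega 2 1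
    - u%:C *: moment_col 3 omega 0 1
    + ('i%C * u%:C) *: moment_col 3 omega 1 0 = 0 <->
  forall l k, (l + k <= 3)%N -> h_moment u omega l k = 0.
Proof.
have colE i l k : l = deg_z (enum_val i) -> k = deg_zb (enum_val i) ->
    (moment_col 3 omega 1 2 - 'i%C *: moment_col 3 omega 2 1
      - u%:C *: moment_col 3 omega 0 1
      + ('i%C * u%:C) *: moment_col 3 omega 1 0) i 0 = - 'i%C * h_moment u omega l k.
  have combE (v1 v2 v3 v4 : 'cV[R[i]]_#|monom 3|) a b c :
      (v1 - a *: v2 - b *: v3 + c *: v4) i 0 =
      v1 i 0 - a * v2 i 0 - b * v3 i 0 + c * v4 i 0 by rewrite !mxE.
  move=> -> ->; rewrite combE !moment_colE // /h_moment.
  by rewrite !(add0n, add1n, add2n); ring: (mul_ii R).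
split=> [col l k lk | hm].
  have [kE lE] : deg_zb (monom_of 3 k l) = k /\ deg_z (monom_of 3 k l) = l.
    by apply: deg_monom_of; rewrite addnC.
  have := colE (enum_rank (monom_of 3 k l)) l k; rewrite enum_rankK => /(_ (esym lE) (esym kE)).
  rewrite col mxE => /(congr1 (fun x => 'i%C * x)).
  by rewrite mulr0 mulrA mulrN mul_ii opprK mul1r.
apply/colP => i; rewrite (colE i _ _ erefl erefl) hm ?mulr0 ?mxE //.
by rewrite addnC deg_monom_le.
Qed.

Lemma h_moment_low :
  (forall i j, (i + j <= 6)%N -> (omega i j)^* = omega j i) ->
  omega 1%N 3%N = 'i%C * t%:C * omega 1%N 1%N + u%:C * omega 2%N 0%N ->
  (h_moment u omega 0 0 = 0 /\ h_moment u omega 0 1 = 0) <->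
  (complex.Re (omega 1%N 2%N) - complex.Im (omega 1%N 2%N) =
     u * (complex.Re (omega 0%N 1%N) - complex.Im (omega 0%N 1%N))
   /\ omega 2%N 2%N = (t + u)%:C * omega 1%N 1%N
        - (2 * u * complex.Im (omega 0%N 2%N))%:C).
Proof.
move=> herm o13; rewrite /h_moment o13.
rewrite -(herm 1%N 2%N) // -(herm 0%N 1%N) // -(herm 0%N 2%N) //.
case: (omega 1%N 2%N) (omega 0%N 1%N) (omega 0%N 2%N) (omega 2%N 2%N) (omega 1%N 1%N)
  => [a b] [c d] [e f] [g0 g1] [k0 k1] /=.
split=> -[/eqP + /eqP]; rewrite ?eq_complex /= => H1 /andP[/eqP H2 /eqP H3].
  move/andP: H1 => [/eqP H1 _].
  by split; [lra|apply/eqP; rewrite eq_complex /=; apply/andP; split; apply/eqP; lra].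
move/eqP: H1 => H1.
by split; apply/eqP; rewrite eq_complex /=; apply/andP; split; apply/eqP; lra.
Qed.

End MomentMatrix.

(** * Comparison of $\omega$ with the RDIS, and the cycle of implications *)

Lemma RDIS3_agree (R : realType) (t u : R) (omega gamma : nat -> nat -> R[i]) :
  (forall i j, (i + j <= 6)%N -> (omega i j)^* = omega j i) ->
  (forall l k, (l + k <= 3)%N -> omega l k.+3 =
     'i%C * t%:C * omega l k.+1 + u%:C * omega l.+1 k) ->
  (forall p q, (p <= q < 3)%N -> gamma p q = omega p q) ->
  (forall p q, gamma q p = (gamma p q)^*) -> P_recurrent t u gamma ->
  forall p q, (p + q <= 6)%N -> omega p q = gamma p q.
Proof.
move=> oherm orec ini gherm [grec _] p q; have [n] := ubnP (p + q)%N.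
elim: n p q => // n IHn.
(* Both families are Hermitian, so $p\le q$ suffices. For $q<3$ these are initial data; beyond, both
   obey the same recurrence, which lowers $p+q$. *)
suff le_case p q : (p <= q)%N -> (p + q < n.+1)%N -> (p + q <= 6)%N ->
    omega p q = gamma p q.
  move=> p q; have [|/ltnW] := leqP p q; first exact: le_case.
  by move=> qp pqn pq6; rewrite -oherm 1?addnC // gherm le_case // addnC.
move=> pq; have [q3|q3] := ltnP q 3; first by rewrite ini // pq.
case: q q3 pq => [|[|[|q]]] // _ _ pqn pq6.
by rewrite grec orec ?IHn //; lia.
Qed.

Lemma eq_moment_mx (R : realType) n (omega gamma : nat -> nat -> R[i]) :
  (forall p q, (p + q <= n + n)%N -> omega p q = gamma p q) ->
  moment_mx n omega = moment_mx n gamma.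
Proof.
move=> og; apply/matrixP => i j; rewrite !mxE /= og // addnACA leq_add //.
  exact: deg_monom_le.
by rewrite addnC deg_monom_le.
Qed.

Unset Implicit Arguments.

Theorem theorem19 (R : realType) (omega : nat -> nat -> R[i]) (t u : R)
    (omega_herm : forall i j : nat, (i + j <= 6)%N ->
       (omega i j)^* = omega j i)
    (omega00 : 0 < omega 0%N 0%N)
    (M_psd : psdmx (moment_mx 3 omega))
    (M_col : moment_col 3 omega 0 3 =
       ('i%C * t%:C) *: moment_col 3 omega 0 1
         + u%:C *: moment_col 3 omega 1 0)
    (ut : u < t) (t2u : t < 2 * u)
    (gamma : nat -> nat -> R[i])
    (gamma_RDIS : is_RDIS 3 omega
       (Z ^+ 3 - cpoly ('i%C * t%:C) * Z - cpoly u%:C * Zbar) gamma) :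
  let h : zpoly R := cpoly 'i%C * (Z - cpoly 'i%C * Zbar) * (Z * Zbar - cpoly u%:C) in
  [<-> (* i *) has_representing_measure (fun p q => (p + q <= 6)%N) omega;
       (* ii *) has_representing_measure (fun p q => true) gamma;
       (* iii *) Lambda 6 omega h = 0 /\ Lambda 6 omega (Z * h) = 0;
       (* iv *) complex.Re (omega 1%N 2%N) - complex.Im (omega 1%N 2%N) =
                  u * (complex.Re (omega 0%N 1%N)
                       - complex.Im (omega 0%N 1%N))
                /\ omega 2%N 2%N = (t + u)%:C * omega 1%N 1%N
                     - (2 * u * complex.Im (omega 0%N 2%N))%:C;
       (* v *) charpolys gamma h;
       (* vi *) moment_col 3 omega 1 2 - 'i%C *: moment_col 3 omega 2 1
                - u%:C *: moment_col 3 omega 0 1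
                + ('i%C * u%:C) *: moment_col 3 omega 1 0 = 0].
Proof.
move=> h.
have [ini gherm grec] := RDIS3_recurrence gamma_RDIS.
have orec := moment_col_recurrence M_col.
have og := RDIS3_agree omega_herm orec ini gherm grec.
(* Since $h$ has degree 3, only moments of total degree at most 6 occur. *)
have ohm p q : (p + q <= 3)%N -> h_moment u omega p q = h_moment u gamma p q.
  by move=> pq; rewrite /h_moment !og //; lia.
have low_iv := h_moment_low omega_herm (orec 1%N 0%N isT).
have low_gamma : h_moment u omega 0 0 = 0 /\ h_moment u omega 0 1 = 0 ->
    forall p q, h_moment u gamma p q = 0.
  by rewrite !ohm // => -[h0 h1]; exact: h_moment_eq0 grec h0 h1.
have measure_gamma : (forall p q, h_moment u gamma p q = 0) ->
    has_representing_measure (fun _ _ => true) gamma.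
  move=> hg; apply: (annihilated_psd_representing_measure ut t2u).
    by split.
  by rewrite -(eq_moment_mx (n := 3) og).
have restrict : has_representing_measure (fun _ _ => true) gamma ->
    has_representing_measure (fun p q => p + q <= 6)%N omega.
  by case=> mu rep; exists mu => p q pq6; rewrite og //; exact: rep.
have measure_low : has_representing_measure (fun p q => p + q <= 6)%N omega ->
    h_moment u omega 0 0 = 0 /\ h_moment u omega 0 1 = 0.
  by case=> mu rep; exact: represents_h_moment ut t2u rep orec.
(* The implications run cyclically; (vi) returns to (i) through a measure for $\gamma$, which also
   represents $\omega$. *)
tfae.
- by move=> /measure_low/low_gamma/measure_gamma.
- by move=> /restrict/measure_low; rewrite Lambda_h // Lambda_Zh.
- by rewrite Lambda_h // Lambda_Zh // => /low_iv.
- by move=> /low_iv/low_gamma/charpolys_h.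
- by move=> /charpolys_h hg; apply/moment_col_h => l k lk; rewrite ohm.
- move=> /moment_col_h hm; apply/restrict/measure_gamma/low_gamma.
  by split; exact: hm.
Qed.
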